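(* If $\pi \in M_{2n,k}$ then $\text{Stab}(\pi)$ under the action $\phi'$ is cyclic. Moreover, if $D_\pi$ is periodic with period $p$, then $\text{Stab}(\pi)$ is generated by $(p,\pi(p) - \pi(0))$.
   Context: Permutations $\pi\in S_m$ are bijections $\mathbb Z_m\to\mathbb Z_m$, written $[\pi(1)\ \pi(2)\ \cdots\ \pi(m)]$, with entries represented by $1,\dots,m$ (so e.g. $\pi(0)=\pi(m)$). For a positive integer $k$ the pointers are $(k,k+1)$; each entry $x$ has left pointer $(x-1,x)$ and right pointer $(x,x+1)$, and the pointer word $W(\pi)$ lists $L(\pi(1))R(\pi(1))\cdots L(\pi(m))R(\pi(m))$ with $(0,1)$ and $(m,m+1)$ removed. Two distinct pointers $p,q$ form a valid pointer context if they appear in the order $p\ldots q\ldots p\ldots q$ or $q\ldots p\ldots q\ldots p$ in $W(\pi)$. With $\pi=[a_1\ \cdots\ a_m]$, set $X_m=(0\ 1\ \cdots\ m)$, $Y_\pi=(a_m\ a_{m-1}\ \cdots\ a_1\ 0)$ (cycle notation) and $C_\pi=Y_\pi\circ X_m$; the strategic pile $\text{SP}(\pi)$ is the set of numbers after $m$ and before $0$ in the cycle of $C_\pi$ containing $0$ and $m$ (empty if they lie in different cycles). A permutation in $S_{2n}$ has maximal strategic pile if $|\text{SP}(\pi)|=2n-1$; in that case $2n$ appears immediately to the left of $1$, and its contraction is the permutation in $S_{2n-1}$ obtained by deleting the entry $2n$ (with $1$ given left pointer $(2n-1,1)$ and $2n-1$ right pointer $(2n-1,1)$). $M_{2n,k}$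 is the set of contractions of permutations in $S_{2n}$ with maximal strategic pile and exactly $k$ valid pointer contexts. Define $\phi:\mathbb Z_{2n-1}\times\mathbb Z_{2n-1}\times S_{2n-1}\to S_{2n-1}$ by $\phi(a,b,\pi)(x)=\pi(x-a)+b$; its restriction $\phi'$ to $\mathbb Z_{2n-1}\times\mathbb Z_{2n-1}\times M_{2n,k}$ is a group action of $\mathbb Z_{2n-1}\times\mathbb Z_{2n-1}$ on $M_{2n,k}$, and $\text{Stab}(\pi)$ is the stabilizer of $\pi$ under it. The difference sequence of $\pi\in S_m$ is $D_\pi\in\mathbb Z_m^m$ with $D_\pi(k)=\pi(k+1)-\pi(k)$ for $1\le k<m$ and $D_\pi(m)=\pi(1)-\pi(m)$; $\pi$ has periodic difference sequence with period $p$ if $p$ is the smallest integer with $0<p<m$ such that $D_\pi(k+p)=D_\pi(k)$ for all $k$ (indices mod $m$). *)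

(* Defs.v *)
From HB Require Import structures.
From mathcomp Require Import all_boot all_order all_algebra all_fingroup all_solvable.

Set Implicit Arguments.
Unset Strict Implicit.
Unset Printing Implicit Defensive.

Import GRing.Theory.
Local Open Scope ring_scope.

(* The additive group of integers mod m, for m > 0. Unlike 'Z_m it is also
   correct for m = 1. It carries both the zmodType structure and the
   finGroupType structure whose law is the same addition. *)
Notation Zmod m := 'I_m.-1.+1.

Section Permutations.
Variable m : nat.
Implicit Types (pi : {perm Zmod m}) (a b : Zmod m).

(* The representative of x in {1, ..., m}. *)
Definition label (x : Zmod m) : nat := if x == 0 then m else x.

(* [:: pi(1); ...; pi(m)], with entries represented in {1, ..., m}. *)
Definition one_line pi : seq nat := [seq label (pi (inZp i)) | i <- iota 1 m].

Definition pointer (k : nat) : nat * nat := (k, k.+1).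

Definition left_pointer (x : nat) : nat * nat := (x.-1, x).
Definition right_pointer (x : nat) : nat * nat := (x, x.+1).

Definition pointer_word pi : seq (nat * nat) :=
  [seq q <- flatten [seq [:: left_pointer x; right_pointer x] | x <- one_line pi]
     | (q != pointer 0) && (q != pointer m)].

Definition valid_context pi (p q : nat * nat) : bool :=
  (p != q) && (subseq [:: p; q; p; q] (pointer_word pi)
            || subseq [:: q; p; q; p] (pointer_word pi)).

(* Contexts are unordered pairs of pointers, hence i < j. *)
Definition num_valid_contexts pi : nat :=
  #|[set ij : 'I_m * 'I_m | [&& (0 < ij.1)%N, (ij.1 < ij.2)%N
      & valid_context pi (pointer ij.1) (pointer ij.2)]]|.

(* path.next c is the permutation written c in cycle notation. *)
Definition X_cycle : 'I_m.+1 -> 'I_m.+1 :=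
  next [seq inord i | i <- iota 0 m.+1].

Definition Y_cycle pi : 'I_m.+1 -> 'I_m.+1 :=
  next (rcons [seq inord x | x <- rev (one_line pi)] ord0).

Definition C_perm pi : 'I_m.+1 -> 'I_m.+1 := Y_cycle pi \o X_cycle.

Definition strategic_pile pi : {set 'I_m.+1} :=
  let c := fingraph.orbit (C_perm pi) ord_max in
  if ord0 \in c then [set x in behead (take (index ord0 c) c)] else set0.

Definition shift_fun a b pi : Zmod m -> Zmod m := fun x => pi (x - a) + b.

Lemma shift_fun_inj a b pi : injective (shift_fun a b pi).
Proof. by move=> x y /addIr /perm_inj /addIr. Qed.

Definition shift_perm a b pi : {perm Zmod m} := perm (@shift_fun_inj a b pi).

Definition shift_to pi (ab : Zmod m * Zmod m) : {perm Zmod m} :=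
  shift_perm ab.1 ab.2 pi.

Lemma shift_to1 : shift_to^~ 1%g =1 id.
Proof.
by move=> pi; apply/permP=> x; rewrite permE /shift_fun /= subr0 addr0.
Qed.

Lemma shift_toM : forall pi, act_morph shift_to pi.
Proof.
move=> pi [a b] [c d]; apply/permP=> x; rewrite !permE /shift_fun /= !permE.
rewrite /shift_fun /=.
have -> : (a * c)%g = a + c by [].
have -> : (b * d)%g = b + d by [].
by rewrite [a + c]addrC opprD !addrA.
Qed.

Definition phi : {action (Zmod m * Zmod m)%type &-> {perm Zmod m}} :=
  TotalAction shift_to1 shift_toM.

(* Indices are mod m, so that the value at m is pi(1) - pi(m). *)
Definition diff_seq pi : {ffun Zmod m -> Zmod m} :=
  [ffun k => pi (k + inZp 1) - pi k].

Definition diff_shift_invariant pi (p : nat) : Prop :=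
  forall k : Zmod m, diff_seq pi (k + inZp p) = diff_seq pi k.

Definition has_diff_period pi (p : nat) : Prop :=
  [/\ (0 < p < m)%N, diff_shift_invariant pi p &
      forall q, (0 < q < m)%N -> diff_shift_invariant pi q -> (p <= q)%N].

End Permutations.

Definition max_strategic_pile (n : nat) (sigma : {perm Zmod (2 * n)}) : bool :=
  #|strategic_pile sigma| == (2 * n - 1)%N.

(* pi is sigma with its largest entry m deleted. *)
Definition is_contraction (m : nat) (sigma : {perm Zmod m})
    (pi : {perm Zmod (m - 1)}) : bool :=
  one_line pi == [seq x <- one_line sigma | x != m].

(* M n k is the set written M_{2n,k}. *)
Definition M (n k : nat) : {set {perm Zmod (2 * n - 1)}} :=
  [set pi | [exists sigma : {perm Zmod (2 * n)},
     [&& max_strategic_pile sigma, num_valid_contexts sigma == k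
       & is_contraction sigma pi]]].

(* Restricting the action phi to an invariant set does not change the
   stabiliser of a point of that set. *)
Definition Stab (m : nat) (pi : {perm Zmod m}) :
    {group (Zmod m * Zmod m)%type} := ('C[pi | phi m])%G.

(* Main.v *)
Require Import Defs.
From HB Require Import structures.
From mathcomp Require Import all_boot all_order all_algebra all_fingroup all_solvable.

Set Implicit Arguments.
Unset Strict Implicit.
Unset Printing Implicit Defensive.

Import GRing.Theory.
Local Open Scope ring_scope.

(** A pair (a, b) fixes pi exactly when pi(x + a) - pi(x) = b for all x, so b is
    determined by a and the first projection embeds Stab(pi) into the cyclic
    group Z_m. The first coordinates that occur are the residues under whose
    translation the difference sequence is invariant; they form a subgroup of
    Z_m, which Euclidean division shows to be generated by its least positive
    representative, the period. *)

Lemma inZpD (n i j : nat) : inZp (i + j) = inZp i + inZp j :> 'I_n.+1.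
Proof. by apply: val_inj; rewrite /= modnDm. Qed.

Section ShiftStabilizer.
Variables (m : nat) (pi : {perm Zmod m}).

(** The fixed-point equation [pi (x - a) + b = pi x], read at [x + a]. *)
Lemma StabP (a b : Zmod m) :
  reflect (forall x, pi (x + a) = pi x + b) ((a, b) \in Stab pi).
Proof.
apply: (iffP astab1P) => [/permP fix_pi x | fix_pi].
  by rewrite -(fix_pi (x + a)) permE /shift_fun /= addrK.
by apply/permP=> x; rewrite permE /shift_fun /= -fix_pi subrK.
Qed.

Lemma Stab_snd (a b : Zmod m) : (a, b) \in Stab pi -> b = pi a - pi 0.
Proof. by move/StabP/(_ 0); rewrite add0r => ->; rewrite addrC addKr. Qed.

Lemma Stab_fst_inj : {in Stab pi &, injective fst}.
Proof. by move=> [a b] [c d] /Stab_snd-> /Stab_snd-> /= ->. Qed.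

(** Equal differences at [x] and [x + p] mean that [pi (x + p) - pi x] does not change when [x]
    grows by 1; by induction it keeps its value at 0. *)
Lemma diff_shift_invariantP (p : nat) :
  diff_shift_invariant pi p <->
  (inZp p, pi (inZp p) - pi 0) \in Stab pi.
Proof.
split=> [inv_p | /StabP fix_p x]; last first.
  by rewrite !ffunE addrAC !fix_p opprD addrACA subrr addr0.
apply/StabP=> x; rewrite -[x]valZpK; elim: (val x) => [|i IHi].
  have -> : inZp 0 = 0 :> Zmod m by apply: val_inj; rewrite /= mod0n.
  by rewrite add0r addrC subrK.
have := inv_p (inZp i); rewrite !ffunE IHi -(addn1 i) inZpD (addrAC _ (inZp p)).
move/(canRL (subrK _)) ->.
by rewrite addrA subrK.
Qed.

Lemma Stab_cyclic : cyclic (Stab pi).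
Proof.
pose f := restrm (subsetT (Stab pi)) (@fst (Zmod m) (Zmod m)).
have inj_f : ('injm f)%g by apply/injmP; apply: Stab_fst_inj.
rewrite -(injm_cyclic inj_f) //.
apply: (cyclicS (subsetT _) : cyclic [set: Zmod m] -> _).
by rewrite Zp_cycle cycle_cyclic.
Qed.

Lemma Stab_cycle_period (p : nat) :
  has_diff_period pi p ->
  Stab pi = <[(inZp p, pi (inZp p) - pi 0)]>%g :> {set _}.
Proof.
case=> /andP[p_gt0 lt_pm] /diff_shift_invariantP Sg min_p.
set g := (X in <[X]>%g) in Sg *.
apply/eqP; rewrite eqEsubset cycle_subG Sg andbT; apply/subsetP=> u Su.
have fst_g q : (g ^+ q)%g.1 = inZp (q * p).
  elim: q => [|q IHq]; first by apply: val_inj; rewrite /= mod0n.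
  by rewrite expgS mulSn inZpD -IHq.
pose q := (u.1 %/ p)%N; pose r := (u.1 %% p)%N.
have u1E : u.1 = inZp (q * p) + inZp r by rewrite -inZpD -divn_eq valZpK.
(* Cancelling [g ^+ q] leaves a stabilizer element whose first coordinate is the remainder [r]. *)
pose v := ((g ^+ q)^-1 * u)%g.
have Sv : v \in Stab pi by rewrite groupM ?groupV ?groupX.
have v1E : v.1 = inZp r.
  have -> : v.1 = - (g ^+ q)%g.1 + u.1 by [].
  by rewrite fst_g u1E addKr.
(* A positive [r] would be an invariant shift smaller than the least one, [p]. *)
have r0 : r = 0%N.
  apply/eqP; rewrite -leqn0 leqNgt; apply/negP=> r_gt0.
  have lt_rp : (r < p)%N by rewrite ltn_mod.
  have inv_r : diff_shift_invariant pi r.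
    apply/diff_shift_invariantP.
    by rewrite -v1E -(Stab_snd (b := v.2)) -surjective_pairing.
  have := min_p r; rewrite r_gt0 (ltn_trans lt_rp lt_pm) leqNgt lt_rp.
  by move/(_ isT inv_r).
(* With [r] zero the first coordinates agree, and these determine stabilizer elements. *)
have -> : u = (g ^+ q)%g.
  apply: Stab_fst_inj => //; first exact: groupX.
  by rewrite fst_g u1E -inZpD r0 addn0.
exact: mem_cycle.
Qed.

End ShiftStabilizer.

Theorem theorem3p8 (n k : nat) (hn : (0 < n)%N)
    (pi : {perm Zmod (2 * n - 1)}) (hpi : pi \in M n k) :
  cyclic (Stab pi) /\
  (forall p : nat, has_diff_period pi p ->
     Stab pi = <[(inZp p, (pi (inZp p) - pi 0)%R)]>%g :> {set _}).
Proof.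
by split=> [|p]; [apply: Stab_cyclic | apply: Stab_cycle_period].
Qed.
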